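(* Let $(C_1,C_2,C_3,C_4)$ be a Descartes quadruple of circles in $\mathbb{C}_\infty$ whose curvatures $b_1,b_2,b_3,b_4$ are integers with $\gcd(b_1,b_2,b_3,b_4)=1$. Then, after scaling the plane by the factor $1/2$ (so that all curvatures are doubled), the quadruple can be realised, by an isometry of the Euclidean plane, as a Descartes quadruple of Gaussian circles; in particular there is a Descartes quadruple of Gaussian circles with curvatures $2b_1,2b_2,2b_3,2b_4$.
   Context: Circles in $\mathbb{C}_\infty$ include lines. An oriented circle has a direction of travel; its interior is the region on its right. The curvature is $1/\text{radius}$ for clockwise orientation, $-1/\text{radius}$ for counterclockwise, and $0$ for lines. A Descartes quadruple is a set of four oriented circles that are pairwise tangent with pairwise disjoint interiors. A Gaussian circle is the image of $\mathbb{R}$ (oriented toward $+\infty$) under a M\''obius transformation $z\mapsto(az+b)/(cz+d)$ with $a,b,c,d\in\mathbb{Z}[i]$ and $ad-bc\in\{\pm1,\pm i\}$. *)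

(* Defs.v *)
From mathcomp Require Import all_boot all_order all_algebra.
From mathcomp Require Import complex.
From mathcomp Require Import boolp classical_sets reals.

Set Implicit Arguments.
Unset Strict Implicit.
Unset Printing Implicit Defensive.

Import Order.TTheory GRing.Theory Num.Theory.
Local Open Scope classical_set_scope.
Local Open Scope ring_scope.
Local Open Scope complex_scope.

(* The Riemann sphere; [None] is the point at infinity. *)
Definition sphere (R : realType) := option R[i].

(* [Line p u] is the line through [p] travelled in the direction [u]; different
   pairs [(p, u)] may describe the same oriented line, so everything below only
   refers to the points, interior and direction of travel of an oriented
   circle. *)
Inductive ocircle (R : realType) : Type :=
| Circle (c : R[i]) (r : R) (_ : 0 < r) (clockwise : bool)
| Line (p u : R[i]) (_ : u != 0).

Section OrientedCircles.
Variable R : realType.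
Implicit Types (K L : ocircle R) (z : R[i]).

Definition points K : set (sphere R) :=
  match K with
  | Circle c r _ _ => [set w | if w is Some z then `|z - c| = r%:C else False]
  | Line p u _ =>
      [set w | if w is Some z then complex.Im ((z - p) / u) = 0 else True]
  end.

(* Direction of travel at a finite point [z] of [K], up to a positive factor. *)
Definition travel K z : R[i] :=
  match K with
  | Circle c _ _ clockwise => (if clockwise then - 'i%C else 'i%C) * (z - c)
  | Line _ u _ => u
  end.

(* The region on the right of the direction of travel. *)
Definition right_side K : set (sphere R) :=
  match K with
  | Circle c r _ true =>
      [set w | if w is Some z then `|z - c| < r%:C else False]
  | Circle c r _ false =>
      [set w | if w is Some z then r%:C < `|z - c| else True]
  | Line p u _ =>
      [set w | if w is Some z then complex.Im ((z - p) / u) < 0 else False]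
  end.

Definition curvature K : R :=
  match K with
  | Circle _ r _ clockwise => if clockwise then r^-1 else - r^-1
  | Line _ _ _ => 0
  end.

(* In the sphere, parallel distinct lines are tangent (at infinity). *)
Definition tangent K L := exists w, points K `&` points L = [set w].

Definition descartes_quadruple (K : 'I_4 -> ocircle R) :=
  forall i j, i != j ->
    tangent (K i) (K j) /\ right_side (K i) `&` right_side (K j) = set0.

Definition real_line : ocircle R := Line 0 (oner_neq0 R[i]).

Definition moebius (a b c d : R[i]) (w : sphere R) : sphere R :=
  match w with
  | Some z => if c * z + d == 0 then None else Some ((a * z + b) / (c * z + d))
  | None => if c == 0 then None else Some (a / c)
  end.

(* [L] is the image of [K], with its direction of travel, under the Moebius
   transformation [z |-> (a z + b) / (c z + d)], whose derivative at [z] is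
   [(a d - b c) / (c z + d)^2]. In the order of [R[i]], [0 < x] says that [x]
   is real and positive, i.e. that the two directions compared agree. *)
Definition moebius_image (a b c d : R[i]) K L :=
  points L = moebius a b c d @` points K /\
  forall z, points K (Some z) -> c * z + d != 0 ->
    0 < (a * d - b * c) / (c * z + d) ^+ 2 * travel K z
        / travel L ((a * z + b) / (c * z + d)).

Definition gaussian_integer z :=
  (complex.Re z \is a Num.int) && (complex.Im z \is a Num.int).

Definition gaussian_circle K :=
  exists a b c d : R[i],
    [/\ [&& gaussian_integer a, gaussian_integer b,
            gaussian_integer c & gaussian_integer d],
        a * d - b * c \in [:: 1; -1; 'i%C; - 'i%C]
      & moebius_image a b c d real_line K].

Definition plane_isometry (f : R[i] -> R[i]) :=
  forall z w, `|f z - f w| = `|z - w|.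

(* [L] is the image of [K] under a similarity [f] of the plane (fixing
   infinity). The orientation is carried along through the interior, so that a
   similarity preserves the sign of curvatures even if it is a reflection. *)
Definition similarity_image (f : R[i] -> R[i]) K L :=
  points L = omap f @` points K /\ right_side L = omap f @` right_side K.

Definition scale_half z : R[i] := z / 2.

End OrientedCircles.

(* Main.v *)
(* An oriented circle is a vector of norm 1 for a Lorentzian form on R^4 (its
   curvature, co-curvature and curvature times center), and the four circles of
   a Descartes quadruple have Gram matrix [2 I - J]. Two quadruples with the
   same curvatures thus differ by a Lorentz transformation fixing the point at
   infinity, i.e. by a Euclidean isometry, and it is enough to find one Gaussian
   quadruple with curvatures [2 b_i]. It is the image of a standard quadruple of
   Gaussian circles under a matrix of SL_2(Z[i]) whose second row [(c, d)] must
   satisfy [|c|^2 = b_1 + b_2], [|d|^2 = b_1 + b_3] and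
   [conj c * d = (b_4 - b_1 - b_2 - b_3) / 2 - i b_1]. By the Descartes relation
   these data form a primitive integral Hermitian form of rank one, and descent
   over the Gaussian integers provides the matrix. *)
Require Import Defs.
From mathcomp Require Import all_boot all_order all_algebra.
From mathcomp Require Import complex.
From mathcomp Require Import boolp classical_sets reals.
From mathcomp Require Import ring lra zify.

Set Implicit Arguments.
Unset Strict Implicit.
Unset Printing Implicit Defensive.

Import Order.TTheory GRing.Theory Num.Theory.
Local Open Scope ring_scope.

(** * Descent over the Gaussian integers *)

(** Applied to both coordinates of the off-diagonal entry, this bounds its new norm by [A ^+ 2 / 2],
    which makes the descent strict. *)
Lemma centered_division (A B : int) : 0 < A ->
  exists q r : int, B = q * A + r /\ 4 * r ^+ 2 <= A ^+ 2.
Proof.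
(* The integer nearest to [B / A], as the floor of [B / A + 1/2]. *)
move=> A0; pose q := ((2 * B + A) %/ (2 * A))%Z.
exists q, (B - q * A); split; first by ring.
have A20 : 2 * A != 0 by lia.
have e := divz_eq (2 * B + A) (2 * A).
have m0 := modz_ge0 (2 * B + A) A20.
have m1 : ((2 * B + A) %% (2 * A))%Z < 2 * A by apply: ltz_pmod; lia.
rewrite -/q in e; set m := modz _ _ in e m0 m1.
have -> : 4 * (B - q * A) ^+ 2 = (m - A) ^+ 2.
  have -> : m = 2 * B + A - q * (2 * A) by lia.
  by ring.
rewrite -subr_ge0; have -> : A ^+ 2 - (m - A) ^+ 2 = m * (2 * A - m) by ring.
by apply: mulr_ge0 => //; rewrite subr_ge0 ltW.
Qed.

(* The matrix [A, B + i n; B - i n, C] is a rank one Hermitian form over the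
   Gaussian integers. The Euclidean algorithm on its off-diagonal entry is
   reduction under SL_2(Z[i]); it ends at [0, 0; 0, 1] by primitivity. *)
Lemma hermitian_descent (A C B n : int) :
  0 <= A -> 0 <= C -> A * C = B ^+ 2 + n ^+ 2 ->
  (forall d : int, (d %| A)%Z -> (d %| C)%Z -> (d %| B)%Z -> (d %| n)%Z ->
    (d %| 1)%Z) ->
  exists a1 a2 b1 b2 c1 c2 d1 d2 : int,
    [/\ a1 * d1 - a2 * d2 - (b1 * c1 - b2 * c2) = 1,
        a1 * d2 + a2 * d1 - (b1 * c2 + b2 * c1) = 0 &
    [/\ c1 ^+ 2 + c2 ^+ 2 = A, d1 ^+ 2 + d2 ^+ 2 = C,
        c1 * d1 + c2 * d2 = B & c1 * d2 - c2 * d1 = n]].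
Proof.
have [k] := ubnP `|A|%N; elim: k A C B n => // k IH A C B n Ak A0 C0 e prim.
have [Az|An] := eqVneq A 0.
  have [Bz nz] : B = 0 /\ n = 0.
    move/eqP: e; rewrite Az mul0r eq_sym paddr_eq0 ?sqr_ge0 // !sqrf_eq0.
    by move=> /andP[/eqP-> /eqP->].
  have C1 : C = 1.
    have : (C %| 1)%Z by apply: prim; rewrite ?Az ?Bz ?nz ?dvdz0.
    rewrite dvdz1; lia.
  by exists 1, 0, 0, 0, 0, 0, 1, 0; rewrite Az Bz nz C1.
have {}A0 : 0 < A by lia.
have [q [B' [eB hB]]] := centered_division B A0.
have [s [n' [en hn]]] := centered_division n A0.
(* The lower right entry after translating the off-diagonal entry by [- (q + i s) A]; the
   determinant stays 0. *)
pose C' := C - 2 * (q * B + s * n) + (q ^+ 2 + s ^+ 2) * A.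
have eC' : A * C' = B' ^+ 2 + n' ^+ 2.
  have -> : A * C' = A * C - 2 * A * (q * B + s * n) +
    (q ^+ 2 + s ^+ 2) * A ^+ 2 by rewrite /C'; ring.
  by rewrite e eB en; ring.
have C'0 : 0 <= C' by rewrite -(pmulr_rge0 _ A0) eC' addr_ge0 ?sqr_ge0.
have C'A : C' < A.
  rewrite -(ltr_pM2l A0) eC'.
  have : 0 < A * A by rewrite mulr_gt0.
  by move: hB hn; rewrite [A ^+ 2]expr2; lia.
(* The quarter turn [0, 1; -1, 0] exchanges the diagonal entries and turns [B' + i n'] into
   [- B' + i n']. *)
case: (IH C' A (- B') n') => //.
- lia.
- lia.
- by rewrite mulrC eC' sqrrN.
- move=> d dC' dA dB dn; rewrite rpredN in dB.
  have dBB : (d %| B)%Z by rewrite eB rpredD // dvdz_mull.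
  have dnn : (d %| n)%Z by rewrite en rpredD // dvdz_mull.
  apply: prim => //.
  have -> : C = C' + (2 * (q * B + s * n) - (q ^+ 2 + s ^+ 2) * A)
    by rewrite /C'; ring.
  by rewrite rpredD // rpredB ?dvdz_mull // rpredD // dvdz_mull.
move=> a1 [a2 [b1 [b2 [c1 [c2 [d1 [d2]]]]]]] [e1 e2 [hc hd hB' hn']].
(* Both reductions are undone on columns: [(c, d)] becomes [(d, - c + (q + i s) d)], and likewise
   for the first row. *)
exists b1, b2, (- a1 + (q * b1 - s * b2)), (- a2 + (q * b2 + s * b1)), d1, d2,
  (- c1 + (q * d1 - s * d2)), (- c2 + (q * d2 + s * d1)).
have eB' : B' = - (c1 * d1 + c2 * d2) by rewrite hB' opprK.
split; first by rewrite -e1; ring.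
  by rewrite -e2; ring.
split=> //.
- have -> : C = C' + (2 * (q * B + s * n) - (q ^+ 2 + s ^+ 2) * A)
    by rewrite /C'; ring.
  by rewrite eB en eB' -hn' -hc -hd; ring.
- by rewrite eB eB' -hd; ring.
- by rewrite en -hn' -hd; ring.
Qed.

(** The last four equations are half the curvatures of the standard Gaussian quadruple moved by a
    matrix with second row [(c, d)]. *)
Lemma descartes_gaussian_matrix (b0 b1 b2 b3 : int) :
  2 * (b0 ^+ 2 + b1 ^+ 2 + b2 ^+ 2 + b3 ^+ 2) = (b0 + b1 + b2 + b3) ^+ 2 ->
  0 <= b0 + b1 -> 0 <= b0 + b2 ->
  (forall d : int, (d %| b0)%Z -> (d %| b1)%Z -> (d %| b2)%Z -> (d %| b3)%Z ->
    (d %| 1)%Z) ->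
  exists x1 x2 y1 y2 c1 c2 d1 d2 : int,
    [/\ x1 * d1 - x2 * d2 - (y1 * c1 - y2 * c2) = 1,
        x1 * d2 + x2 * d1 - (y1 * c2 + y2 * c1) = 0 &
    [/\ b0 = c2 * d1 - c1 * d2, b1 = c1 ^+ 2 + c2 ^+ 2 - b0,
        b2 = d1 ^+ 2 + d2 ^+ 2 - b0 &
        b3 = 2 * (c1 * d1 + c2 * d2) + b0 + b1 + b2]].
Proof.
move=> rel A0 C0 prim.
(* The square of the sum of the curvatures is even, hence so is the sum, and the off-diagonal entry
   [B] is an integer. *)
have /dvdzP[B eB] : (2 %| b3 - b0 - b1 - b2)%Z.
  have : (2 %| (b0 + b1 + b2 + b3) ^+ 2)%Z by rewrite -rel dvdz_mulr.
  rewrite dvdzE abszX Euclid_dvdX // andbT => h.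
  have -> : b3 - b0 - b1 - b2 = (b0 + b1 + b2 + b3) - 2 * (b0 + b1 + b2)
    by ring.
  by rewrite rpredB // dvdz_mulr.
have eb3 : b3 = B * 2 + b0 + b1 + b2 by rewrite -eB; ring.
have [|||d hA hC hB hn|] :=
  @hermitian_descent (b0 + b1) (b0 + b2) B (- b0) => //.
(* Multiplied by 4, the vanishing of the determinant is the Descartes relation. *)
- apply: (@mulfI _ 4) => //; apply/eqP; rewrite -subr_eq0; apply/eqP.
  transitivity ((b0 + b1 + b2 + b3) ^+ 2 - 2 * (b0 ^+ 2 + b1 ^+ 2 + b2 ^+ 2 +
    b3 ^+ 2)).
    by rewrite eb3; ring.
  by rewrite rel subrr.
- rewrite rpredN in hn.
  have h1 : (d %| b1)%Z by rewrite -(rpredDl _ hn).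
  have h2 : (d %| b2)%Z by rewrite -(rpredDl _ hn).
  by apply: prim => //; rewrite eb3 !rpredD // dvdz_mulr.
move=> x1 [x2 [y1 [y2 [c1 [c2 [d1 [d2 [E1 E2 [h1 h2 h3 h4]]]]]]]]].
exists x1, x2, y1, y2, c1, c2, d1, d2; split=> //; split.
- by rewrite -[LHS]opprK -h4; ring.
- by rewrite h1; ring.
- by rewrite h2; ring.
- by rewrite h3 eb3; ring.
Qed.

(** * Descartes quadruples as Gram matrices *)

(* Coordinates of the oriented circle [b |z|^2 - 2 Re (conj n z) + b' = 0] with
   [n = nx + i ny] and [|n|^2 - b b' = 1]: curvature [b], co-curvature [b'] (the
   curvature of the image under inversion in the unit circle) and, for a proper
   circle, [n = b * center]. The region on the right is where the left-hand
   side is negative. *)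
Record cvec (R : Type) := CVec { curv : R; cocurv : R; nx : R; ny : R }.

(** Polarisation of [|n|^2 - b b']. For clockwise circles at distance [d] between centers it is
    [(r^2 + r'^2 - d^2) / (2 r r')], which is -1 at external tangency. *)
Definition cdot (R : fieldType) (v w : cvec R) : R :=
  nx v * nx w + ny v * ny w - (curv v * cocurv w + curv w * cocurv v) / 2.

Definition descartes_gram (R : fieldType) (V : 'I_4 -> cvec R) :=
  forall i j, cdot (V i) (V j) = if i == j then 1 else -1.

Section GramMatrices.
Variable R : realFieldType.
Implicit Types V W : 'I_4 -> cvec R.

Definition cvec_mx V : 'M[R]_4 :=
  \matrix_(i, j) [:: curv (V i); cocurv (V i); nx (V i); ny (V i)]`_j.

Definition form_mx : 'M[R]_4 := \matrix_(i, j)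
  (nth [::] [:: [:: 0; - (1/2); 0; 0]; [:: - (1/2); 0; 0; 0]; [:: 0; 0; 1; 0];
    [:: 0; 0; 0; 1]] i)`_j.
Definition form_inv : 'M[R]_4 := \matrix_(i, j)
  (nth [::] [:: [:: 0; -2; 0; 0]; [:: -2; 0; 0; 0]; [:: 0; 0; 1; 0];
    [:: 0; 0; 0; 1]] i)`_j.
Definition gram_mx : 'M[R]_4 := \matrix_(i, j) if i == j then 1 else -1.
Definition gram_inv : 'M[R]_4 := \matrix_(i, j) if i == j then 1/4 else - (1/4).

Lemma form_mxK : form_mx *m form_inv = 1%:M.
Proof.
apply/matrixP=> -[[|[|[|[|//]]]] ?] -[[|[|[|[|//]]]] ?];
  rewrite !(mxE, big_ord_recl, big_ord0) /=; by field.
Qed.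

Lemma gram_mxK : gram_mx *m gram_inv = 1%:M.
Proof.
apply/matrixP=> -[[|[|[|[|//]]]] ?] -[[|[|[|[|//]]]] ?];
  rewrite !(mxE, big_ord_recl, big_ord0) /=; by field.
Qed.

Lemma cvec_mx_gram V : descartes_gram V ->
  cvec_mx V *m form_mx *m (cvec_mx V)^T = gram_mx.
Proof.
move=> hV; apply/matrixP=> i j; rewrite [RHS]mxE -(hV i j).
by rewrite !(mxE, big_ord_recl, big_ord0) /= /cdot; field.
Qed.

(** Inverting the Gram identity turns relations between circles into relations between
    coordinates. *)
Lemma descartes_form_mx V : descartes_gram V ->
  (cvec_mx V)^T *m gram_inv *m cvec_mx V = form_inv.
Proof.
move=> /cvec_mx_gram hV.
have : cvec_mx V *m (form_mx *m (cvec_mx V)^T *m gram_inv) = 1%:M.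
  by rewrite !mulmxA hV gram_mxK.
move=> /mulmx1C; rewrite -!mulmxA => h.
by rewrite -[LHS]mul1mx -(mulmx1C form_mxK) -!mulmxA h mulmx1.
Qed.

(** This is the curvature entry of the inverted identity; the corresponding entry of [form_inv] is
    0. *)
Lemma descartes_relation V : descartes_gram V ->
  2 * \sum_i curv (V i) ^+ 2 = (\sum_i curv (V i)) ^+ 2.
Proof.
move=> /descartes_form_mx /matrixP /(_ 0 0).
rewrite !(mxE, big_ord_recl, big_ord0) /= => h.
set l := (X in X = _) in h.
match goal with |- ?a = ?b => have -> : a = b + 4 * l by rewrite /l; field end.
by rewrite h mulr0 addr0.
Qed.

(** The six reals encode the isometry with translation [(a1, a2)] and orthogonal linear part with
    columns [(p, q)] and [(r, s)]; the formulas are its action on coordinates. *)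
Lemma descartes_congruence V W : descartes_gram V -> descartes_gram W ->
  (forall i, curv (V i) = curv (W i)) ->
  exists a1 a2 p q r s : R,
  [/\ [/\ p ^+ 2 + q ^+ 2 = 1, r ^+ 2 + s ^+ 2 = 1 & p * r + q * s = 0],
      [/\ p ^+ 2 + r ^+ 2 = 1, q ^+ 2 + s ^+ 2 = 1 & p * q + r * s = 0] &
  forall i, [/\ nx (W i) = curv (V i) * a1 + nx (V i) * p + ny (V i) * r,
     ny (W i) = curv (V i) * a2 + nx (V i) * q + ny (V i) * s &
     cocurv (W i) = curv (V i) * (a1 ^+ 2 + a2 ^+ 2) + cocurv (V i) +
       2 * nx (V i) * (a1 * p + a2 * q) + 2 * ny (V i) * (a1 * r + a2 * s)]].
Proof.
move=> /cvec_mx_gram hV /cvec_mx_gram hW hb.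
pose MV := cvec_mx V; pose MW := cvec_mx W.
have uV : MV \in unitmx.
  have : MV *m (form_mx *m MV^T *m gram_inv) = 1%:M
    by rewrite !mulmxA hV gram_mxK.
  by move/mulmx1_unit=> [].
(* Since both quadruples have the same Gram matrix, this change of coordinates preserves the
   form. *)
pose T := invmx MV *m MW.
have eW : MW = MV *m T by rewrite mulKVmx.
have hT : T *m form_mx *m T^T = form_mx.
  rewrite /T trmx_mul -!mulmxA (mulmxA form_mx) (mulmxA MW) (mulmxA MW) hW -hV.
  by rewrite trmx_inv !mulmxA mulVmx // mul1mx mulmxK // unitmx_tr.
have hT' : T^T *m form_inv *m T = form_inv.
  have : T *m (form_mx *m T^T *m form_inv) = 1%:M
    by rewrite !mulmxA hT form_mxK.
  move=> /mulmx1C; rewrite -!mulmxA => h.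
  by rewrite -[LHS]mul1mx -(mulmx1C form_mxK) -!mulmxA h mulmx1.
(* Equal curvatures mean that [T] fixes the null vector of the point at
   infinity, so it comes from a Euclidean isometry. *)
pose e0 : 'cV[R]_4 := delta_mx 0 0; pose e1 : 'cV[R]_4 := delta_mx 1 0.
have T0 : T *m e0 = e0.
  have WV : MW *m e0 = MV *m e0.
    by rewrite -!colE; apply/matrixP=> i j; rewrite !mxE /= hb.
  by rewrite /T -mulmxA WV mulKmx.
clearbody T.
have T1 : T^T *m e1 = e1.
  have Fe : form_inv *m e0 = - 2 *: e1.
    by apply/matrixP=> -[[|[|[|[|//]]]] ?] j;
      rewrite ord1 -colE !mxE /= ?mulr0 ?mulr1.
  have : T^T *m (form_inv *m e0) = form_inv *m e0.
    by rewrite -[X in _ *m (_ *m X) = _]T0 !mulmxA hT'.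
  rewrite Fe -scalemxAr => /scalerI; apply.
  by rewrite oppr_eq0 pnatr_eq0.
have t0 i : T i 0 = (i == 0)%:R.
  by have /matrixP/(_ i 0) := T0; rewrite -colE !mxE andbT.
have t1 i : T 1 i = (i == 1)%:R.
  by have /matrixP/(_ i 0) := T1; rewrite -colE !mxE andbT.
pose o2 : 'I_4 := lift 0 (lift 0 (0 : 'I_2)).
pose o3 : 'I_4 := lift 0 (lift 0 (lift 0 (0 : 'I_1))).
have l1 : lift 0 (0 : 'I_3) = 1 :> 'I_4 by apply/val_inj.
have E i j : form_mx i j = T i o2 * T j o2 + T i o3 * T j o3
    - (T i 0 * T j 1 + T i 1 * T j 0) / 2.
  rewrite -[in LHS]hT !(mxE, big_ord_recl, big_ord0) /= l1 -/o2 -/o3.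
  by field.
have E' i j : form_inv i j = T o2 i * T o2 j + T o3 i * T o3 j
    - 2 * (T 0 i * T 1 j + T 1 i * T 0 j).
  rewrite -[in LHS]hT' !(mxE, big_ord_recl, big_ord0) /= l1 -/o2 -/o3.
  by ring.
have e00 := E 0 0; have e02 := E 0 o2; have e03 := E 0 o3.
have e22 := E o2 o2; have e33 := E o3 o3; have e23 := E o2 o3.
have f22 := E' o2 o2; have f33 := E' o3 o3; have f23 := E' o2 o3.
rewrite !mxE !t0 /= in e00 e02 e03 e22 e33 e23.
rewrite !mxE !t1 /= in f22 f33 f23.
exists (T 0 o2), (T 0 o3), (T o2 o2), (T o2 o3), (T o3 o2), (T o3 o3).
split.
- by split; lra.
- by split; lra.
move=> i.
have eWi j : MW i j = (MV *m T) i j by rewrite eW.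
move: (eWi 1) (eWi o3) (eWi o2).
rewrite !(mxE, big_ord_recl, big_ord0) /= ?l1 -/o2 -/o3 ?t0 ?t1 /=.
rewrite !(mul0r, mulr0, add0r, addr0, mul1r, mulr1) => w1 w3 w2.
split; [by rewrite w2; ring|by rewrite w3; ring|].
(* Invariance of the form forces the co-curvature column of [T]. *)
have t01 : T 0 1 = T 0 o2 ^+ 2 + T 0 o3 ^+ 2 by lra.
have t21 : T o2 1 = 2 * (T 0 o2 * T o2 o2 + T 0 o3 * T o2 o3) by lra.
have t31 : T o3 1 = 2 * (T 0 o2 * T o3 o2 + T 0 o3 * T o3 o3) by lra.
by rewrite w1 t01 t21 t31; ring.
Qed.

End GramMatrices.

(** * Circles as vectors *)

Section Circles.
Local Open Scope classical_set_scope.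
Local Open Scope complex_scope.

Variable R : realType.
Implicit Types (K L : ocircle R) (z : R[i]) (w : sphere R) (v : cvec R).

Definition abs2 z : R := complex.Re z ^+ 2 + complex.Im z ^+ 2.

Lemma normc_ltE z (r : R) : 0 < r -> (`|z| < r%:C) = (abs2 z < r ^+ 2).
Proof.
move=> r0; rewrite normc_def ltcR -{1}(ger0_norm (ltW r0)) -sqrtr_sqr.
by rewrite ltr_sqrt // exprn_gt0.
Qed.

Lemma normc_gtE z (r : R) : 0 < r -> (r%:C < `|z|) = (r ^+ 2 < abs2 z).
Proof.
move=> r0; rewrite normc_def ltcR -{1}(ger0_norm (ltW r0)) -sqrtr_sqr.
by rewrite !ltNge ler_sqrt // sqr_ge0.
Qed.

Lemma normc_eqE z (r : R) : 0 < r -> `|z| = r%:C <-> abs2 z = r ^+ 2.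
Proof.
move=> r0; split.
  by rewrite /abs2 normc_def => /complexI <-;
    rewrite sqr_sqrtr // addr_ge0 ?sqr_ge0.
by rewrite normc_def -/(abs2 z) => ->; rewrite sqrtr_sqr ger0_norm // ltW.
Qed.

Lemma normc_eq z z' : abs2 z = abs2 z' -> `|z| = `|z'|.
Proof. by rewrite /abs2 !normc_def => ->. Qed.

(** For a line, [n = - i u / |u|] is the unit normal pointing to the right. *)
Definition cvec_of K : cvec R :=
  match K with
  | Circle c r _ cw =>
      let b := if cw then r^-1 else - r^-1 in
      CVec b (b * abs2 c - b * r ^+ 2) (b * complex.Re c) (b * complex.Im c)
  | Line p u _ =>
      let m := Num.sqrt (abs2 u) in
      CVec 0 (2 * (complex.Re p * complex.Im u - complex.Im p * complex.Re u)
        / m)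
        (complex.Im u / m) (- complex.Re u / m)
  end.

Lemma curvE K : curv (cvec_of K) = curvature K.
Proof. by case: K. Qed.

Lemma abs2_gt0 u : u != 0 -> 0 < abs2 u.
Proof.
case: u => x y; rewrite eq_complex /= /abs2 /= negb_and => h.
rewrite lt_def addr_ge0 ?sqr_ge0 // andbT paddr_eq0 ?sqr_ge0 // !sqrf_eq0.
by rewrite negb_and.
Qed.

Lemma cdot_cvec_of K : cdot (cvec_of K) (cvec_of K) = 1.
Proof.
case: K => [c r r0 cw|p u u0]; rewrite /cdot /=.
  rewrite /abs2; have rn : r != 0 by rewrite gt_eqF.
  by case: cw; field; rewrite ?rn.
have m0 := abs2_gt0 u0.
have m2 : Num.sqrt (abs2 u) ^+ 2 = abs2 u by rewrite sqr_sqrtr // ltW.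
have mn : Num.sqrt (abs2 u) != 0 by rewrite gt_eqF // sqrtr_gt0.
rewrite !mul0r addr0 mul0r subr0.
have -> : complex.Im u / Num.sqrt (abs2 u) * (complex.Im u / Num.sqrt (abs2
  u)) +
  - complex.Re u / Num.sqrt (abs2 u) * (- complex.Re u / Num.sqrt (abs2 u)) =
  abs2 u / Num.sqrt (abs2 u) ^+ 2 by rewrite /abs2; field.
by rewrite m2 divff // gt_eqF.
Qed.

(* At infinity the sign of the circle equation is that of its leading
   coefficient. *)
Definition qform v w : R :=
  if w is Some z then
    curv v * abs2 z - 2 * (nx v * complex.Re z + ny v * complex.Im z) + cocurv v
  else curv v.

Lemma qform_Circle c r (r0 : 0 < r) cw z :
  qform (cvec_of (Circle c r0 cw)) (Some z) =
  (if cw then r^-1 else - r^-1) * (abs2 (z - c) - r ^+ 2).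
Proof. by case: z c cw => x y [cx cy] [] /=; rewrite /abs2 /=; ring. Qed.

Lemma Im_divc z (u : R[i]) : u != 0 -> complex.Im (z / u) =
  (complex.Im z * complex.Re u - complex.Re z * complex.Im u) / abs2 u.
Proof.
case: z u => x y [a b] /abs2_gt0 /=; rewrite /abs2 /= => h.
by field; rewrite gt_eqF.
Qed.

Lemma qform_Line p u (u0 : u != 0) z :
  qform (cvec_of (Line p u0)) (Some z) =
  2 * Num.sqrt (abs2 u) * complex.Im ((z - p) / u).
Proof.
have m0 := abs2_gt0 u0.
have m2 : Num.sqrt (abs2 u) ^+ 2 = abs2 u by rewrite sqr_sqrtr // ltW.
have mn : Num.sqrt (abs2 u) != 0 by rewrite gt_eqF // sqrtr_gt0.
rewrite Im_divc // -[in X in _ = _ * (_ / X)]m2 /=.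
by case: z p => x y [a b] /=; field.
Qed.

Lemma pointsE K w : points K w <-> qform (cvec_of K) w = 0.
Proof.
case: K => [c r r0 cw|p u u0]; case: w => [z|].
- rewrite qform_Circle /= normc_eqE //; split=> [->|/eqP].
    by rewrite subrr mulr0.
  rewrite mulf_eq0 subr_eq0 => /orP[|/eqP //].
  by case: cw; rewrite ?oppr_eq0 invr_eq0 gt_eqF.
- split=> //= /eqP; case: cw; by rewrite ?oppr_eq0 invr_eq0 gt_eqF.
- rewrite qform_Line /=; split=> [->|/eqP]; first by rewrite mulr0.
  rewrite !mulf_eq0 pnatr_eq0 /= => /orP[|/eqP //].
  by rewrite gt_eqF // sqrtr_gt0 abs2_gt0.
- by [].
Qed.

Lemma right_sideE K w : right_side K w <-> qform (cvec_of K) w < 0.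
Proof.
case: K => [c r r0 [|]|p u u0]; case: w => [z|].
- rewrite qform_Circle /= normc_ltE // pmulr_rlt0 ?invr_gt0 //.
  by rewrite subr_lt0.
- by rewrite /= ltNge invr_ge0 ltW.
- by rewrite qform_Circle /= normc_gtE // nmulr_rlt0 ?oppr_lt0 ?invr_gt0 //
    subr_gt0.
- by rewrite /= oppr_lt0 invr_gt0 r0.
- rewrite qform_Line /= pmulr_rlt0 // mulr_gt0 // sqrtr_gt0.
  exact: abs2_gt0.
- by rewrite /= ltxx.
Qed.

(** The vector is [- i] times half the gradient of the circle equation, so the negative side lies on
    the right. *)
Lemma travelE K z : points K (Some z) -> exists2 l : R, 0 < l &
  travel K z = l%:C * ((curv (cvec_of K) * complex.Im z - ny (cvec_of K)) +i*
                       (nx (cvec_of K) - curv (cvec_of K) * complex.Re z)).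
Proof.
case: K => [c r r0 cw|p u u0] /= _; [exists r => //|exists (Num.sqrt (abs2 u))].
- have rn : r != 0 by rewrite gt_eqF.
  case: z c => x y [cx cy]; case: cw => /=; simpc;
  by congr (_ +i* _); field.
- by rewrite sqrtr_gt0 abs2_gt0.
have mn : Num.sqrt (abs2 u) != 0 by rewrite gt_eqF // sqrtr_gt0 abs2_gt0.
case: u u0 mn => a b /= u0 mn; simpc.
by congr (_ +i* _); field.
Qed.

Lemma cvec_of_surj v : cdot v v = 1 -> exists K, cvec_of K = v.
Proof.
case: v => b b' x y; rewrite /cdot /= => h.
have [b0|bn] := eqVneq b 0.
  subst b; have xy : x ^+ 2 + y ^+ 2 = 1 by lra.
  have u0 : (- y) +i* x != 0 :> R[i].
    rewrite eq_complex /= negb_and; apply/orP.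
    have [x0|] := eqVneq x 0; last by right.
    have [y0|] := eqVneq y 0; last by rewrite oppr_eq0; left.
    by move: xy; rewrite x0 y0 expr0n /= addr0 => /esym/eqP; rewrite oner_eq0.
  (* The foot of the perpendicular from 0 is [b' / 2] times the unit normal, and the direction is
     [i] times that normal. *)
  exists (Line ((b' * x / 2) +i* (b' * y / 2)) u0).
  have e : abs2 ((- y) +i* x) = 1 by rewrite /abs2 /= -xy; ring.
  rewrite /= e sqrtr1 !divr1 opprK.
  by congr CVec; rewrite -[RHS]mulr1 -[X in _ = _ * X]xy; field.
have r0 : 0 < `|b|^-1 by rewrite invr_gt0 normr_gt0.
exists (Circle ((x / b) +i* (y / b)) r0 (0 < b)).
have e : (if 0 < b then (`|b|^-1)^-1 else - (`|b|^-1)^-1) = b.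
  rewrite invrK; case: ltrP => b0; first by rewrite gtr0_norm.
  by rewrite ler0_norm // opprK.
rewrite /= e /abs2 /= exprVn real_normK ?num_real //.
have -> : b' = (x ^+ 2 + y ^+ 2 - 1) / b by apply: (mulIf bn);
  rewrite divfK //; lra.
by congr CVec; field.
Qed.

End Circles.

(** * Tangency and disjoint interiors in coordinates *)

Section Tangency.
Local Open Scope classical_set_scope.
Local Open Scope complex_scope.

Variable R : realType.
Implicit Types (K L : ocircle R) (z h : R[i]) (w : sphere R) (v : cvec R).

Definition gradx v z := curv v * complex.Re z - nx v.
Definition grady v z := curv v * complex.Im z - ny v.

Lemma qformD v z h : qform v (Some (z + h)) = qform v (Some z) +
  2 * (gradx v z * complex.Re h + grady v z * complex.Im h) + curv v * abs2 h.
Proof. by case: z h => x y [hx hy]; rewrite /gradx /grady /= /abs2 /=;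
  ring. Qed.

Lemma cdot_grad v v' z : cdot v v' =
  gradx v z * gradx v' z + grady v z * grady v' z
  - (curv v * qform v' (Some z) + curv v' * qform v (Some z)) / 2.
Proof. by case: z => x y; rewrite /gradx /grady /cdot /= /abs2 /=; field. Qed.

(* At a common point the two gradients are unit vectors, and both equations
   decrease along minus their sum; so disjointness forces the sum to vanish. *)
Lemma disjoint_cdot v v' w : cdot v v = 1 -> cdot v' v' = 1 ->
  qform v w = 0 -> qform v' w = 0 ->
  (forall w, ~ (qform v w < 0 /\ qform v' w < 0)) -> cdot v v' = -1.
Proof.
move=> v1 v1' q q' disj; apply/eqP; apply: contraT => pn; exfalso.
case: w q q' => [z|] q q'.
- have := cdot_grad v v z; have := cdot_grad v' v' z; have := cdot_grad v v' z.
  rewrite q q' v1 v1' !mulr0 addr0 mul0r !subr0.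
  set m := gradx v z; set k := grady v z; set m' := gradx v' z;
    set k' := grady v' z.
  set p := cdot v v' in pn * => ep e' e.
  have p1 : 0 < 1 + p.
    have : 0 <= (m + m') ^+ 2 + (k + k') ^+ 2 by rewrite addr_ge0 ?sqr_ge0.
    have -> : (m + m') ^+ 2 + (k + k') ^+ 2 =
      (m * m + k * k) + (m' * m' + k' * k') + 2 * (m * m' + k * k') by ring.
    rewrite -e -e' -ep; have -> : 1 + 1 + 2 * p = 2 * (1 + p) by ring.
    rewrite pmulr_rge0 // le_eqVlt => /orP[/eqP h|//].
    by case/eqP: pn; lra.
  (* Moving by minus the gradient sum over [s] changes each equation by
     [2 (1 + p) / s * (curv / s - 1)], negative once [s] exceeds both curvatures. *)
  pose s := 1 + `|curv v| + `|curv v'|.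
  have s0 : 0 < s by rewrite /s; have := normr_ge0 (curv v);
    have := normr_ge0 (curv v'); lra.
  apply: (disj (Some (z + (- (m + m') / s) +i* (- (k + k') / s)))).
  have aux t : t < s -> 2 * (1 + p) / s * (t / s - 1) < 0.
    move=> ts; rewrite pmulr_rlt0 ?divr_gt0 ?mulr_gt0 // subr_lt0.
    by rewrite ltr_pdivrMr // mul1r.
  have := ler_norm (curv v); have := ler_norm (curv v').
  have := normr_ge0 (curv v); have := normr_ge0 (curv v') => g g' g2 g3.
  rewrite !qformD q q' !add0r -/m -/k -/m' -/k' /abs2 /=.
  have sn : s != 0 by rewrite gt_eqF.
  split.
    have -> : 2 * (m * (- (m + m') / s) + k * (- (k + k') / s)) +
      curv v * ((- (m + m') / s) ^+ 2 + (- (k + k') / s) ^+ 2) =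
      - 2 / s * ((m * m + k * k) + (m * m' + k * k')) + curv v / s ^+ 2 *
       ((m * m + k * k) + (m' * m' + k' * k') + 2 * (m * m' + k * k')) by field.
    rewrite -e -e' -ep; have := aux (curv v); rewrite {1}/s => /(_ ltac:(lra)).
    by congr (_ < _); field.
  have -> : 2 * (m' * (- (m + m') / s) + k' * (- (k + k') / s)) +
    curv v' * ((- (m + m') / s) ^+ 2 + (- (k + k') / s) ^+ 2) =
    - 2 / s * ((m' * m' + k' * k') + (m * m' + k * k')) + curv v' / s ^+ 2 *
     ((m * m + k * k) + (m' * m' + k' * k') + 2 * (m * m' + k * k')) by field.
  rewrite -e -e' -ep; have := aux (curv v'); rewrite {1}/s => /(_ ltac:(lra)).
  by congr (_ < _); field.
(* At infinity both curvatures vanish, and a point far out along the sum of the normals lies in both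
   half-planes. *)
move: q q'; rewrite /= => q q'.
move: v1 v1' pn; rewrite /cdot q q' !mul0r !addr0 mul0r !subr0.
set p := nx v * nx v' + _ => v1 v1' pn.
have p1 : 0 < 1 + p.
  have : 0 <= (nx v + nx v') ^+ 2 + (ny v + ny v') ^+ 2
    by rewrite addr_ge0 ?sqr_ge0.
  have -> : (nx v + nx v') ^+ 2 + (ny v + ny v') ^+ 2 =
    (nx v * nx v + ny v * ny v)
    + (nx v' * nx v' + ny v' * ny v') + 2 * p by rewrite /p; ring.
  rewrite v1 v1'; have -> : 1 + 1 + 2 * p = 2 * (1 + p) by ring.
  rewrite pmulr_rge0 // le_eqVlt => /orP[/eqP h|//].
  by case/eqP: pn; lra.
pose t := (1 + `|cocurv v| + `|cocurv v'|) / (1 + p).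
have tp : t * (1 + p) = 1 + `|cocurv v| + `|cocurv v'|
  by rewrite divfK // gt_eqF.
apply: (disj (Some ((t * (nx v + nx v')) +i* (t * (ny v + ny v'))))).
have := ler_norm (cocurv v); have := ler_norm (cocurv v').
have := normr_ge0 (cocurv v); have := normr_ge0 (cocurv v') => g g' g2 g3.
rewrite /= q q' !mul0r !add0r; split.
  have -> : nx v * (t * (nx v + nx v')) + ny v * (t * (ny v + ny v')) =
    t * ((nx v * nx v + ny v * ny v) + p) by rewrite /p; ring.
  by rewrite v1 tp; lra.
have -> : nx v' * (t * (nx v + nx v')) + ny v' * (t * (ny v + ny v')) =
  t * ((nx v' * nx v' + ny v' * ny v') + p) by rewrite /p; ring.
by rewrite v1' tp; lra.
Qed.

(** The gradients at the common point are opposite, so the two equations at [z + h] add up to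
    [(curv v + curv v') |h|^2]. Were this negative, a displacement sharing it equally would reach
    both interiors. *)
Lemma disjoint_curv v v' w : cdot v v = 1 -> cdot v' v' = 1 ->
  qform v w = 0 -> qform v' w = 0 ->
  (forall w, ~ (qform v w < 0 /\ qform v' w < 0)) -> 0 <= curv v + curv v'.
Proof.
move=> v1 v1' q q' disj; have p := disjoint_cdot v1 v1' q q' disj.
case: w q q' => [z|] q q'; last by move: q q' => /= -> ->; rewrite addr0.
have := cdot_grad v v z; have := cdot_grad v' v' z; have := cdot_grad v v' z.
rewrite q q' v1 v1' p !mulr0 addr0 mul0r !subr0.
set m := gradx v z; set k := grady v z; set m' := gradx v' z;
  set k' := grady v' z.
move=> ep e' e.
have /eqP : (m + m') ^+ 2 + (k + k') ^+ 2 = 0.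
  have -> : (m + m') ^+ 2 + (k + k') ^+ 2 =
    (m * m + k * k) + (m' * m' + k' * k') + 2 * (m * m' + k * k') by ring.
  by rewrite -e -e' -ep; ring.
rewrite paddr_eq0 ?sqr_ge0 // !sqrf_eq0 !addr_eq0 => /andP[/eqP em /eqP ek].
have {}em : m' = - m by rewrite em opprK.
have {}ek : k' = - k by rewrite ek opprK.
rewrite leNgt; apply/negP => neg.
(* The displacement [h] has [|h|^2 = l] and component [c * l] along the gradient
   which gives both equations the value [l * (curv v + curv v') / 2]. *)
pose c := (curv v' - curv v) / 4; pose l := (1 + c ^+ 2)^-1.
have c1 : 0 < 1 + c ^+ 2 by rewrite ltr_pwDl ?sqr_ge0.
have l0 : 0 < l by rewrite invr_gt0.
have l1 : (1 + c ^+ 2) * l = 1 by rewrite divff // gt_eqF.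
pose s := c * l; pose t := Num.sqrt (l - s ^+ 2).
have t2 : t ^+ 2 = l - s ^+ 2.
  rewrite sqr_sqrtr // /s.
  have -> : l - (c * l) ^+ 2 = l * ((1 + c ^+ 2) * l - c ^+ 2 * l)
    by rewrite l1; ring.
  by rewrite mulrDl mul1r addrK mulr_ge0 // ltW.
pose h := (m * s - k * t) +i* (k * s + m * t).
have ah : abs2 h = l.
  have -> : abs2 h = (m * m + k * k) * (s ^+ 2 + t ^+ 2) by rewrite /abs2 /=;
    ring.
  by rewrite -e t2; ring.
have gh : m * complex.Re h + k * complex.Im h = s.
  have -> : m * complex.Re h + k * complex.Im h = (m * m + k * k) * s
    by rewrite /=; ring.
  by rewrite -e mul1r.
have neg2 : l * (curv v + curv v') < 0 by rewrite pmulr_rlt0.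
apply: (disj (Some (z + h))); rewrite !qformD q q' !add0r -/m -/k -/m' -/k' em
  ek ah.
split.
  have -> : 2 * (m * complex.Re h + k * complex.Im h) + curv v * l =
    l * (curv v + curv v') / 2.
    by rewrite gh /s /c; field.
  by lra.
have -> : 2 * (- m * complex.Re h + - k * complex.Im h) + curv v' * l =
  l * (curv v + curv v') / 2.
  have -> : - m * complex.Re h + - k * complex.Im h =
    - (m * complex.Re h + k * complex.Im h) by ring.
  by rewrite gh /s /c; field.
by lra.
Qed.

End Tangency.

(** * Images of the real line and similarities *)

Section Moebius.
Local Open Scope classical_set_scope.
Local Open Scope complex_scope.

Variable R : realType.
Implicit Types (K L : ocircle R) (a b c d z : R[i]) (w : sphere R) (v : cvec R).

(** [wedge] and [inner] are the imaginary and real parts of [z] times the conjugate of [z']. *)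
Definition wedge z z' : R :=
  complex.Im z * complex.Re z' - complex.Re z * complex.Im z'.
Definition inner z z' : R :=
  complex.Re z * complex.Re z' + complex.Im z * complex.Im z'.

(* The image of the real line under [z |-> (a z + b) / (c z + d)], provided that
   [|a d - b c| = 1]: substitute the inverse map into [2 Im z]. *)
Definition moebius_cvec a b c d : cvec R :=
  CVec (2 * wedge c d) (2 * wedge a b) (wedge a d - wedge b c)
    (inner b c - inner a d).

Lemma qform_moebius a b c d z :
  qform (moebius_cvec a b c d) (Some z) = 2 * wedge (d * z - b) (a - c * z).
Proof.
case: a b c d z => a1 a2 [b1 b2] [c1 c2] [d1 d2] [x y].
by rewrite /= /abs2 /wedge /inner /=; ring.
Qed.

Lemma wedge0P z z' : z' != 0 -> wedge z z' = 0 <-> complex.Im (z / z') = 0.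
Proof.
move=> z0; rewrite (Im_divc z z0) -/(wedge z z'); split=> [->|/eqP];
  first by rewrite mul0r.
by rewrite mulf_eq0 invr_eq0 (gt_eqF (abs2_gt0 z0)) orbF => /eqP.
Qed.

Lemma wedge0l z : wedge 0 z = 0. Proof. by rewrite /wedge /= !mul0r subrr. Qed.
Lemma wedge0r z : wedge z 0 = 0. Proof. by rewrite /wedge /= !mulr0 subrr. Qed.
Lemma wedgeC z z' : wedge z z' = - wedge z' z.
Proof. by rewrite /wedge; ring. Qed.

Lemma moebius_points a b c d K : a * d - b * c != 0 ->
  cvec_of K = moebius_cvec a b c d ->
  points K = moebius a b c d @` points (real_line R).
Proof.
move=> D0 eK; apply/seteqP; split=> [[z|]|w].
- rewrite pointsE eK qform_moebius => /eqP.
  rewrite mulf_eq0 pnatr_eq0 /= => /eqP hw.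
  have [e|n] := eqVneq (a - c * z) 0.
    exists None => //=; move/eqP: e; rewrite subr_eq0 => /eqP ea.
    have cn : c != 0 by apply: contraNneq D0 => c0;
      rewrite ea c0 mul0r mul0r mulr0 subrr.
    by rewrite (negbTE cn) ea mulrC mulKf.
  exists (Some ((d * z - b) / (a - c * z))) => /=.
    by rewrite subr0 divr1; apply/wedge0P.
  have e1 : c * ((d * z - b) / (a - c * z)) + d =
    (a * d - b * c) / (a - c * z) by field.
  rewrite e1 mulf_eq0 invr_eq0 (negbTE D0) (negbTE n) /=; congr Some.
  by field; rewrite n D0.
- rewrite pointsE eK /= => /eqP; rewrite mulf_eq0 pnatr_eq0 /= => /eqP hw.
  have [c0|cn] := eqVneq c 0; first by exists None => //=; rewrite c0 eqxx.
  exists (Some (- d / c)) => /=.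
    by rewrite subr0 divr1 mulNr /=;
      case: (d / c) (wedge0P d cn) => x y /= [+ _] => ->;
        rewrite ?oppr0 // wedgeC hw oppr0.
  by rewrite mulrC divfK // addNr eqxx.
case=> -[z|] /= hz <-; rewrite pointsE eK.
- rewrite subr0 divr1 in hz; case: eqVneq => [e|n].
    have -> : d = - (c * z) by apply/eqP; rewrite -addr_eq0 addrC e.
    case: z hz {e} => x y /= ->; rewrite /wedge;
      case: c D0 eK => c1 c2 _ _ /=; ring.
  rewrite qform_moebius.
  have -> : d * ((a * z + b) / (c * z + d)) - b =
    (a * d - b * c) / (c * z + d) * z by field.
  have -> : a - c * ((a * z + b) / (c * z + d)) =
    (a * d - b * c) / (c * z + d) by field.
  have -> : wedge ((a * d - b * c) / (c * z + d) * z)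
    ((a * d - b * c) / (c * z + d)) = 0.
    apply/wedge0P; first by rewrite mulf_eq0 invr_eq0 (negbTE D0) (negbTE n).
    by rewrite mulrAC divff ?mul1r // mulf_eq0 invr_eq0 (negbTE D0) (negbTE n).
  by rewrite mulr0.
- case: eqVneq => [->|cn]; first by rewrite /= wedge0l mulr0.
  by rewrite qform_moebius [c * _]mulrC divfK // subrr wedge0r mulr0.
Qed.

(** At real [x] the direction of travel is a positive multiple of
    [(a d - b c) conj(c x + d) / (c x + d)]; divided into the derivative it leaves a positive
    multiple of [1 / |c x + d|^2]. *)
Lemma moebius_real_line a b c d K : a * d - b * c != 0 ->
  cvec_of K = moebius_cvec a b c d -> moebius_image a b c d (real_line R) K.
Proof.
move=> D0 eK; have eP := moebius_points D0 eK; split=> // x hx n.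
have : points K (Some ((a * x + b) / (c * x + d))).
  by rewrite eP; exists (Some x) => //=; rewrite (negbTE n).
move=> /travelE[l l0]; rewrite eK => ->.
set z := (a * x + b) / _; set E := (X in _ / (_ * X)).
have -> : E = (a * d^* - b * c^*) - (c * d^* - c^* * d) * z.
  rewrite /E; case: z {E} => z1 z2;
  case: (a) (b) (c) (d) => a1 a2 [b1 b2] [c1 c2] [d1 d2].
  by rewrite /= /wedge /inner /=; simpc; congr (_ +i* _); ring.
have xJ : x^* = x.
  have : complex.Im x = 0 by move: hx; rewrite /= subr0 divr1.
  by case: x {hx n z E} => x1 x2 /= ->; rewrite oppr0.
have eJ : (c * x + d)^* = c^* * x + d^* by rewrite rmorphD rmorphM /= xJ.
have -> : (a * d^* - b * c^*) - (c * d^* - c^* * d) * z =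
  (a * d - b * c) * (c^* * x + d^*) / (c * x + d) by rewrite /z; field.
rewrite [travel _ _]/= mulr1.
have nJ : c^* * x + d^* != 0 by rewrite -eJ conjc_eq0.
have ln : l%:C != 0 by rewrite eq_complex /= gt_eqF.
have -> : (a * d - b * c) / (c * x + d) ^+ 2 /
  (l%:C * ((a * d - b * c) * (c^* * x + d^*) / (c * x + d))) =
  (l%:C * ((c * x + d) * (c^* * x + d^*)))^-1.
  by field; rewrite ?n ?nJ ?ln ?D0.
by rewrite invr_gt0 mulr_gt0 ?ltcR // lt_def mulf_neq0 //= -eJ mulcJ_ge0.
Qed.

End Moebius.

Section Similarity.
Local Open Scope classical_set_scope.
Local Open Scope complex_scope.

Variable R : realType.
Implicit Types (K L : ocircle R) (f g : R[i] -> R[i]).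

Lemma similarity_image_qform f g K L (s : sphere R -> R) : cancel f g ->
  cancel g f ->
  (forall w, 0 < s w) ->
  (forall w, qform (cvec_of L) (omap f w) = s w * qform (cvec_of K) w) ->
  similarity_image f K L.
Proof.
move=> fK gK s0 fq.
have omapK : cancel (omap g) (omap f) by case=> //= z; rewrite gK.
split; apply/seteqP; split=> w.
- move=> hw; exists (omap g w) => //; apply/pointsE/eqP.
  by move/pointsE/eqP: hw; rewrite -{1}(omapK w) fq mulf_eq0 gt_eqF.
- by case=> w' /pointsE hw <-; apply/pointsE; rewrite fq hw mulr0.
- move=> hw; exists (omap g w) => //; apply/right_sideE.
  by move/right_sideE: hw; rewrite -{1}(omapK w) fq pmulr_rlt0.
- by case=> w' /right_sideE hw <-; apply/right_sideE; rewrite fq pmulr_rlt0.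
Qed.

Lemma descartes_similarity f (C D : 'I_4 -> ocircle R) : injective f ->
  (forall i, similarity_image f (C i) (D i)) ->
  descartes_quadruple C -> descartes_quadruple D.
Proof.
move=> fI sim hC i j ij; have [[w hw] disj] := hC i j ij.
have [[pi ri] [pj rj]] := (sim i, sim j).
have oI : injective (omap f) by move=> [x|] [y|] //= [/fI->].
split.
  exists (omap f w); rewrite pi pj; apply/seteqP;
    split=> [_ [[x hx <-] [y hy /oI e]]|_ ->] /=.
    by subst y; congr omap; have : (points (C i) `&` points (C j)) x by [];
      rewrite hw.
  have [h1 h2] : (points (C i) `&` points (C j)) w by rewrite hw.
  by split; exists w.
rewrite ri rj; apply/seteqP; split=> [_ [[x hx <-] [y hy /oI e]]|//]; subst y.
by have : (right_side (C i) `&` right_side (C j)) x by []; rewrite disj.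
Qed.

End Similarity.

(** * Gaussian Descartes quadruples from unimodular matrices *)

Section GaussianQuadruple.
Local Open Scope classical_set_scope.
Local Open Scope complex_scope.

Variable R : realType.
Implicit Types a b c d z : R[i].

Lemma gaussian_integerD z z' : gaussian_integer z -> gaussian_integer z' ->
  gaussian_integer (z + z').
Proof.
case: z z' => x y [x' y'] /andP[/= hx hy] /andP[/= hx' hy'].
by rewrite /gaussian_integer /= !rpredD.
Qed.

Lemma gaussian_integerN z : gaussian_integer z -> gaussian_integer (- z).
Proof.
by case: z => x y /andP[/= hx hy]; rewrite /gaussian_integer /= !rpredN hx hy.
Qed.

Lemma gaussian_integerM z z' : gaussian_integer z -> gaussian_integer z' ->
  gaussian_integer (z * z').
Proof.
case: z z' => x y [x' y'] /andP[/= hx hy] /andP[/= hx' hy'].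
by rewrite /gaussian_integer /= rpredB ?rpredD ?rpredM.
Qed.

Lemma gaussian_integer_i : gaussian_integer ('i%C : R[i]).
Proof. by rewrite /gaussian_integer /= rpred0 rpred1. Qed.

Lemma gaussian_integer_int (m n : int) :
  gaussian_integer (m%:~R +i* n%:~R : R[i]).
Proof. by rewrite /gaussian_integer /= !intr_int. Qed.

(* The row [(a, b)] times the matrices [1 0; 0 1], [-1 i; 0 1], [1 0; -i -1] and
   [1-i -1; -i -1], which send the real line to the Descartes quadruple formed
   by the lines Im z = 0, Im z = 1 and the circles of diameter 1 between them
   that touch the real line at 0 and at 1. *)
Definition std_entries a b : seq (R[i] * R[i]) :=
  [:: (a, b); (- a, 'i%C * a + b); (a - 'i%C * b, - b);
    (a - 'i%C * a - 'i%C * b, - a - b)].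

Definition quad_cvec a b c d (i : 'I_4) : cvec R :=
  let ab := nth (0, 0) (std_entries a b) i in
  let cd := nth (0, 0) (std_entries c d) i in
  moebius_cvec ab.1 ab.2 cd.1 cd.2.

Lemma std_entries_gaussian a b (i : 'I_4) : gaussian_integer a ->
  gaussian_integer b ->
  gaussian_integer (nth (0, 0) (std_entries a b) i).1 &&
  gaussian_integer (nth (0, 0) (std_entries a b) i).2.
Proof.
move=> ga gb; have gi := gaussian_integer_i; case: i => -[|[|[|[|//]]]] /= _;
apply/andP; split; repeat first [assumption | apply: gaussian_integerN
  | apply: gaussian_integerD | apply: gaussian_integerM].
Qed.

Lemma std_entries_det a b c d (i : 'I_4) :
  let ab := nth (0, 0) (std_entries a b) i in
  let cd := nth (0, 0) (std_entries c d) i in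
  ab.1 * cd.2 - ab.2 * cd.1 =
  if val i == 0%N then a * d - b * c else - (a * d - b * c).
Proof. by case: i => -[|[|[|[|//]]]] /= _; ring. Qed.

Lemma quad_cvec_gaussian a b c d i K :
  gaussian_integer a -> gaussian_integer b -> gaussian_integer c ->
    gaussian_integer d ->
  a * d - b * c = 1 -> cvec_of K = quad_cvec a b c d i -> gaussian_circle K.
Proof.
move=> ga gb gc gd e eK.
have := std_entries_det a b c d i; rewrite /= e => det.
have /andP[g1 g2] := std_entries_gaussian i ga gb.
have /andP[g3 g4] := std_entries_gaussian i gc gd.
exists (nth (0, 0) (std_entries a b) i).1, (nth (0, 0) (std_entries a b) i).2,
  (nth (0, 0) (std_entries c d) i).1, (nth (0, 0) (std_entries c d) i).2.
split; first by rewrite g1 g2 g3 g4.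
  by rewrite det; case: ifP; rewrite !inE eqxx ?orbT.
by apply: moebius_real_line => //; rewrite det; case: ifP;
  rewrite ?oppr_eq0 oner_eq0.
Qed.

Lemma quad_cvec_gram a b c d : a * d - b * c = 1 ->
  descartes_gram (quad_cvec a b c d).
Proof.
case: a b c d => a1 a2 [b1 b2] [c1 c2] [d1 d2] [e1 e2].
(* [D] is the squared modulus of the determinant; every Gram entry equals [D] or [- D] as a
   polynomial. *)
pose D := (a1 * d1 - a2 * d2 - (b1 * c1 - b2 * c2)) ^+ 2 +
  (a1 * d2 + a2 * d1 - (b1 * c2 + b2 * c1)) ^+ 2.
have D1 : D = 1 by rewrite /D e1 e2; ring.
move=> i j; rewrite -D1; move: i j.
by move=> [[|[|[|[|//]]]] ?] [[|[|[|[|//]]]] ?];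
  rewrite /cdot /quad_cvec /moebius_cvec /wedge /inner /= /D; field.
Qed.

End GaussianQuadruple.

Lemma big_ord4 (T : Type) (op : T -> T -> T) (idx : T) (F : 'I_4 -> T) :
  \big[op/idx]_(i < 4) F i =
  op (F (@Ordinal 4 0 isT)) (op (F (@Ordinal 4 1 isT))
    (op (F (@Ordinal 4 2 isT)) (op (F (@Ordinal 4 3 isT)) idx))).
Proof.
rewrite !big_ord_recl big_ord0.
by congr (op (F _) (op (F _) (op (F _) (op (F _) _)))); apply: val_inj.
Qed.

(** * Realising prescribed coordinates by a scaled isometric copy *)

Section Realisation.
Local Open Scope classical_set_scope.
Local Open Scope complex_scope.

Variable R : realType.
Implicit Types (C D : 'I_4 -> ocircle R).

Lemma descartes_pair (K L : ocircle R) :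
  tangent K L -> right_side K `&` right_side L = set0 ->
  cdot (cvec_of K) (cvec_of L) = -1 /\ 0 <= curvature K + curvature L.
Proof.
move=> [w hw] disj.
have [/pointsE hK /pointsE hL] : (points K `&` points L) w by rewrite hw.
have {}disj w' : ~ (qform (cvec_of K) w' < 0 /\ qform (cvec_of L) w' < 0).
  move=> [/right_sideE hK' /right_sideE hL'].
  by have : (right_side K `&` right_side L) w' by []; rewrite disj.
have [K1 L1] := (cdot_cvec_of K, cdot_cvec_of L).
split; first exact: disjoint_cdot hK hL disj.
by rewrite -!curvE; exact: disjoint_curv hK hL disj.
Qed.

Lemma descartes_quadruple_gram C : descartes_quadruple C ->
  descartes_gram (fun i => cvec_of (C i)).
Proof.
move=> hC i j; have [->|ij] := eqVneq i j; first exact: cdot_cvec_of.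
by have [t d] := hC i j ij; have [] := descartes_pair t d.
Qed.

(* The effect of the scaling [z |-> z / 2] on coordinates. *)
Definition halve (v : cvec R) := CVec (2 * curv v) (cocurv v / 2) (nx v) (ny v).

Lemma halve_gram (V : 'I_4 -> cvec R) : descartes_gram V ->
  descartes_gram (fun i => halve (V i)).
Proof. by move=> h i j; rewrite -h /cdot /=; field. Qed.

Lemma scale_halfE z : @scale_half R z =
  (complex.Re z / 2) +i* (complex.Im z / 2).
Proof.
have n2 : 2 != 0 :> R[i] by rewrite pnatr_eq0.
apply: (mulIf n2); rewrite divfK // mulr_natr mulr2n.
by case: z => x y /=; congr (_ +i* _) => /=; field.
Qed.

(** The circles [D] are read off from [W]; as they turn out to be similar images of [C], tangency
    and disjointness are inherited. *)
Lemma descartes_realisation C (W : 'I_4 -> cvec R) : descartes_quadruple C ->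
  descartes_gram W -> (forall i, curv (W i) = 2 * curvature (C i)) ->
  exists (phi : R[i] -> R[i]) D, [/\ plane_isometry phi,
    forall i, similarity_image (phi \o @scale_half R) (C i) (D i),
    descartes_quadruple D & forall i, cvec_of (D i) = W i].
Proof.
move=> hC hW hc.
have hV := halve_gram (descartes_quadruple_gram hC).
have [i|a1 [a2 [p [q [r [s [[e1 e2 e3] [f1 f2 f3] eW]]]]]]] :=
  descartes_congruence hV hW.
  by rewrite hc -curvE.
pose phi (z : R[i]) := (a1 + p * complex.Re z + r * complex.Im z) +i*
  (a2 + q * complex.Re z + s * complex.Im z).
(* The inverse of halving followed by [phi]: transpose the orthogonal part and double. *)
pose g (z : R[i]) := (2 * (p * (complex.Re z - a1) +
  q * (complex.Im z - a2))) +i*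
  (2 * (r * (complex.Re z - a1) + s * (complex.Im z - a2))).
have W1 i : cdot (W i) (W i) = 1 by rewrite hW eqxx.
pose D i := projT1 (cid (cvec_of_surj (W1 i))).
have DE i : cvec_of (D i) = W i by rewrite /D; case: cid.
have fK : cancel (phi \o @scale_half R) g.
  move=> [x y]; rewrite /= scale_halfE /phi /g /=; congr (_ +i* _).
    transitivity ((p ^+ 2 + q ^+ 2) * x + (p * r + q * s) * y); first by field.
    by rewrite e1 e3; ring.
  transitivity ((p * r + q * s) * x + (r ^+ 2 + s ^+ 2) * y); first by field.
  by rewrite e2 e3; ring.
have gK : cancel g (phi \o @scale_half R).
  move=> [x y]; rewrite /= scale_halfE /phi /g /=; congr (_ +i* _).
    transitivity (a1 + (p ^+ 2 + r ^+ 2) * (x - a1) +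
      (p * q + r * s) * (y - a2)); first by field.
    by rewrite f1 f3; ring.
  transitivity (a2 + (p * q + r * s) * (x - a1) +
    (q ^+ 2 + s ^+ 2) * (y - a2)); first by field.
  by rewrite f2 f3; ring.
have sim i : similarity_image (phi \o @scale_half R) (C i) (D i).
  (* The circle equation is halved at finite points, whereas at infinity its value, the curvature,
     doubles. *)
  apply: (similarity_image_qform
    (s := fun w => if w is Some _ then 2^-1 else 2) fK gK).
    by case=> [_|]; rewrite ?invr_gt0 ltr0n.
  case=> [[x y]|]; rewrite DE; last by rewrite /= hc curvE.
  rewrite /= scale_halfE /phi /abs2 /=; have [-> -> ->] := eW i.
  rewrite hc -curvE /=; set v := cvec_of (C i).
  set E := (X in _ = X).
  (* The two sides differ only by defects of orthonormality of the columns. *)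
  transitivity (E + curv v / 2 * ((p ^+ 2 + q ^+ 2 - 1) * x ^+ 2 +
     (r ^+ 2 + s ^+ 2 - 1) * y ^+ 2 + 2 * (p * r + q * s) * x * y) - nx v * ((p ^+ 2 + q ^+ 2 - 1) * x +
       (p * r + q * s) * y)
     - ny v * ((p * r + q * s) * x + (r ^+ 2 + s ^+ 2 - 1) * y)).
    by rewrite /E /abs2 /=; field.
  by rewrite e1 e2 e3 !subrr !(mul0r, mulr0, addr0, subr0).
exists phi, D; split=> //.
- move=> [x y] [x' y']; apply: normc_eq; rewrite /abs2 /=.
  transitivity ((p ^+ 2 + q ^+ 2) * (x - x') ^+ 2 +
    (r ^+ 2 + s ^+ 2) * (y - y') ^+ 2 + 2 * (p * r + q * s) * (x - x') * (y - y')); first by ring.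
  by rewrite e1 e2 e3; ring.
- exact: descartes_similarity (can_inj fK) sim hC.
Qed.

End Realisation.

Theorem theorem7p1 (R : realType) (C : 'I_4 -> ocircle R) (b : 'I_4 -> int)
  (hC : descartes_quadruple C)
  (hb : forall i, curvature (C i) = (b i)%:~R)
  (hgcd : \big[gcdz/0]_(i < 4) b i = 1) :
  exists (phi : complex R -> complex R) (D : 'I_4 -> ocircle R),
    [/\ plane_isometry phi,
        forall i, similarity_image (phi \o @scale_half R) (C i) (D i),
        descartes_quadruple D,
        forall i, gaussian_circle (D i)
      & forall i, curvature (D i) = (2 * b i)%:~R].
Proof.
pose i0 := @Ordinal 4 0 isT; pose i1 := @Ordinal 4 1 isT.
pose i2 := @Ordinal 4 2 isT; pose i3 := @Ordinal 4 3 isT.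
(* With [i = i0] these sums include the diagonal entries of the Hermitian form. *)
have ge0 i j : i != j -> 0 <= b i + b j.
  move=> ij; have [t d] := hC i j ij; have [_] := descartes_pair t d.
  by rewrite !hb -rmorphD /= ler0z.
have [|||d h0 h1 h2 h3|] :=
  @descartes_gaussian_matrix (b i0) (b i1) (b i2) (b i3).
- have := descartes_relation (descartes_quadruple_gram hC).
  rewrite !big_ord4 -/i0 -/i1 -/i2 -/i3 !curvE !hb => h.
  apply/eqP; rewrite -(eqr_int R); apply/eqP.
  by move: h; rewrite !addr0 !addrA => h;
    rewrite !(rmorphM, rmorphD, rmorphXn) /=.
- exact: ge0.
- exact: ge0.
- have : (d %| \big[gcdz/0%R]_(i < 4) b i)%Z; last by rewrite hgcd.
  by rewrite big_ord4 !dvdz_gcd h0 h1 h2 h3 dvdz0.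
move=> x1 [x2 [y1 [y2 [c1 [c2 [d1 [d2 [E1 E2 [h0 h1 h2 h3]]]]]]]]].
pose gi (m n : int) : complex R := Complex m%:~R n%:~R.
have det : gi x1 x2 * gi d1 d2 - gi y1 y2 * gi c1 c2 = 1.
  rewrite /gi; simpc; congr Complex.
    by rewrite -[RHS]/(1%:~R) -E1; ring.
  by rewrite -[RHS]/(0%:~R) -E2; ring.
have curvW i : curv (quad_cvec (gi x1 x2) (gi y1 y2) (gi c1 c2) (gi d1 d2) i)
  = (2 * b i)%:~R.
  case: i => -[|[|[|[|//]]]] p; rewrite (bool_irrelevance p isT) /= /wedge /=.
  - by rewrite -/i0 h0; ring.
  - by rewrite -/i1 h1 h0; ring.
  - by rewrite -/i2 h2 h0; ring.
  - by rewrite -/i3 h3 h2 h1 h0; ring.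
have [|phi [D [iso sim desc DE]]] := descartes_realisation hC (quad_cvec_gram
  det).
  by move=> i; rewrite curvW hb rmorphM.
exists phi, D; split=> // i.
  by apply: (quad_cvec_gaussian _ _ _ _ det (DE i));
    exact: gaussian_integer_int.
by rewrite -curvE DE curvW.
Qed.
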